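(* Let $A=\{a_1<\cdots<a_k\}$ be a set of $k$ distinct integers. Let $\mathcal{E}_n$ be the arrangement in $\mathbb{R}^n$ consisting of the hyperplanes $x_i-x_j=a_1,\ldots,a_k$ for $1\le i<j\le n$. Let $$A_r(t,x)=\sum_{n\ge 0}\left(\sum_{f:[n]\to[r]}t^{a(f)}\right)\frac{x^n}{n!},$$ where the inner sum is over all functions $f:[n]\to[r]$ and $a(f)$ denotes the number of pairs $(i,j)$ with $1\le i<j\le n$ such that $f(i)-f(j)\in A$. Then $$1+q\sum_{n\ge 1}\overline{\chi}_{\mathcal{E}_n}(q,t)\frac{x^n}{n!}=\left(\lim_{r\to\infty}\frac{A_r(t,x)}{A_{r-1}(t,x)}\right)^q,$$ where the limit is taken in the sense of convergence of formal power series.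
   Context: A hyperplane arrangement $\mathcal{A}$ in $\mathbb{R}^n$ is a finite set of affine hyperplanes of $\mathbb{R}^n$. A subset $\mathcal{B}\subseteq\mathcal{A}$ is central if its hyperplanes have non-empty intersection (the empty subset is central, with intersection $\mathbb{R}^n$). The rank of a central subset is $r(\mathcal{B})=n-\dim\bigcap\mathcal{B}$, and the rank $r$ of $\mathcal{A}$ is the largest rank of a central subset of $\mathcal{A}$. The coboundary polynomial of $\mathcal{A}$ is $$\overline{\chi}_{\mathcal{A}}(q,t)=\sum_{\mathcal{B}\subseteq\mathcal{A}\text{ central}} q^{\,r-r(\mathcal{B})}(t-1)^{|\mathcal{B}|}.$$ Here $[m]=\{1,\ldots,m\}$ and $[0]=\emptyset$. For a formal power series $F$ in $x$ with constant term $1$, $F^q=\exp(q\log F)$, with $q$ an indeterminate. Convergence: $\lim_{r\to\infty}F_r(t,x)=F(t,x)$ means that for all $a,b$ the coefficient of $t^ax^b$ in $F_r(t,x)$ equals the coefficient of $t^ax^b$ in $F(t,x)$ for all $r$ larger than some constant $N(a,b)$. *)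

(* Defs.v *)
From HB Require Import structures.
From mathcomp Require Import all_boot all_order all_algebra finmap.
From mathcomp Require Import all_classical all_reals.

Set Implicit Arguments.
Unset Strict Implicit.
Unset Printing Implicit Defensive.

Import Order.TTheory GRing.Theory Num.Theory.

Local Open Scope fset_scope.
Local Open Scope classical_set_scope.
Local Open Scope ring_scope.

Definition is_hyperplane (R : realType) (n : nat) (H : set 'rV[R]_n) : Prop :=
  exists c : 'rV[R]_n, exists b : R,
    c != 0 /\ H = [set x | \sum_(i < n) c 0 i * x 0 i = b].

Record arrangement (R : realType) (n : nat) := Arrangement {
  hyperplanes :> {fset set 'rV[R]_n};
  _ : forall H, H \in hyperplanes -> is_hyperplane H }.

(* The intersection of the empty family is the whole space. *)
Definition flat (R : realType) (n : nat) (B : {fset set 'rV[R]_n}) :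
  set 'rV[R]_n := \bigcap_(H in [set` B]) H.

Definition central (R : realType) (n : nat) (B : {fset set 'rV[R]_n}) : Prop :=
  flat B !=set0.

(* The dimension of a nonempty affine subspace S = p + W, where the linear
   subspace W is determined by S; the value is 0 if S is not of this form. *)
Definition affine_dim (R : realType) (n : nat) (S : set 'rV[R]_n) : nat :=
  xget 0%N [set d | exists (p : 'rV[R]_n) (W : {vspace 'rV[R]_n}),
    S = [set p + w | w in [set` W]] /\ d = \dim W].

Definition central_rank (R : realType) (n : nat) (B : {fset set 'rV[R]_n}) :
  nat := (n - affine_dim (flat B))%N.

Definition arr_rank (R : realType) (n : nat) (Arr : arrangement R n) : nat :=
  (\max_(B <- fpowerset Arr | `[< central B >]) central_rank B)%N.

(* Polynomials in q and t are elements of {poly {poly rat}}: q is the outer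
   variable 'X, and t is the inner one, 'X%:P. *)
Definition coboundary (R : realType) (n : nat) (Arr : arrangement R n) :
    {poly {poly rat}} :=
  \sum_(B <- fpowerset Arr | `[< central B >])
    'X ^+ (arr_rank Arr - central_rank B) * ('X%:P - 1) ^+ #|` B|.

Definition diff_hyperplane (R : realType) (n : nat) (i j : 'I_n) (a : int) :
  set 'rV[R]_n := [set x | x 0 i - x 0 j = a%:~R].

Arguments diff_hyperplane R {n} i j a.

Lemma diff_hyperplaneP (R : realType) (n : nat) (i j : 'I_n) (a : int) :
  (i < j)%N -> is_hyperplane (diff_hyperplane R i j a).
Proof.
move=> ij; have nij : i != j by rewrite -val_eqE /= ltn_eqF.
exists (delta_mx 0 i - delta_mx 0 j), a%:~R; split.
  apply/eqP => /matrixP/(_ 0 i); rewrite !mxE !eqxx (negbTE nij) /= subr0.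
  by apply/eqP; rewrite oner_eq0.
rewrite /diff_hyperplane; congr mkset; apply/funext => x; congr (_ = _).
have pick k : \sum_(l < n) (l == k)%:R * x 0 l = x 0 k.
  rewrite (bigD1 k) //= eqxx mul1r big1 ?addr0 // => l /negbTE ->.
  exact: mul0r.
rewrite -(pick i) -(pick j) -sumrB.
by apply: eq_bigr => l _; rewrite !mxE /= mulrBl.
Qed.

Definition E_hyperplanes (R : realType) (A : {fset int}) (n : nat) :
    {fset set 'rV[R]_n} :=
  [fset diff_hyperplane R p.1 p.2 a
     | p in [pred p : 'I_n * 'I_n | (p.1 < p.2)%N], a in A].

Lemma E_hyperplanesP (R : realType) (A : {fset int}) (n : nat) H :
  H \in E_hyperplanes R A n -> is_hyperplane H.
Proof.
by move=> /imfset2P[p /= pP [a _ ->]]; exact: diff_hyperplaneP.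
Qed.

Definition E_arr (R : realType) (A : {fset int}) (n : nat) : arrangement R n :=
  Arrangement (@E_hyperplanesP R A n).

(* A formal power series in x over K is its sequence of coefficients. The
   operations are named functions because the canonical product on functions
   nat -> K is the pointwise one. *)
Definition fps (K : Type) := nat -> K.

Definition fps_one (K : nzRingType) : fps K := fun n => (n == 0%N)%:R.

Definition fps_sub (K : nzRingType) (f g : fps K) : fps K := fun n => f n - g n.

Definition fps_mul (K : nzRingType) (f g : fps K) : fps K :=
  fun n => \sum_(i < n.+1) f i * g (n - i)%N.

Definition fps_pow (K : nzRingType) (f : fps K) (m : nat) : fps K :=
  iter m (fps_mul f) (@fps_one K).

(* The substitution \sum_m c m * u ^ m, for u without constant term: u ^ m then
   has order at least m, so only the terms m <= n contribute to x ^ n. *)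
Definition fps_subst (K : nzRingType) (c : nat -> K) (u : fps K) : fps K :=
  fun n => \sum_(m < n.+1) c m * fps_pow u m n.

(* fps_inv, fps_log and the divisor of fps_div expect a series with constant
   term 1, and fps_exp a series with constant term 0; fps_exp and fps_log are
   meant for a ring K in which the positive integers are invertible. *)
Definition fps_inv (K : nzRingType) (f : fps K) : fps K :=
  fps_subst (fun m => (-1) ^+ m) (fps_sub f (@fps_one K)).

Definition fps_div (K : nzRingType) (f g : fps K) : fps K :=
  fps_mul f (fps_inv g).

Definition fps_exp (K : unitRingType) (g : fps K) : fps K :=
  fps_subst (fun m => m`!%:R^-1) g.

(* The term m = 0 vanishes because 0^-1 = 0. *)
Definition fps_log (K : unitRingType) (f : fps K) : fps K :=
  fps_subst (fun m => (-1) ^+ m.+1 * m%:R^-1) (fps_sub f (@fps_one K)).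

(* F ^ q = exp (q log F), with coefficients in K[q]. *)
Definition fps_powq (K : idomainType) (F : fps K) : fps {poly K} :=
  fps_exp (fun n => 'X * (fps_log F n)%:P).

(* Convergence of series in t and x, viewed as series in x over Q[t]. *)
Definition fps_cvg (F_ : nat -> fps {poly rat}) (F : fps {poly rat}) : Prop :=
  forall a b : nat, exists N : nat, forall r : nat, (N < r)%N ->
    (F_ r b)`_a = (F b)`_a.

(* [n] and [r] are replaced by 'I_n and 'I_r; the shift by one affects neither
   the order of the indices nor the differences of the values. *)
Definition a_stat (A : {fset int}) (n r : nat) (f : {ffun 'I_n -> 'I_r}) : nat :=
  #|[pred p : 'I_n * 'I_n |
      (p.1 < p.2)%N && ((f p.1 : nat)%:Z - (f p.2 : nat)%:Z \in A)]|.

Definition A_series (A : {fset int}) (r : nat) : fps {poly rat} :=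
  fun n => (n`!%:R^-1 : rat) *: \sum_(f : {ffun 'I_n -> 'I_r}) 'X^(a_stat A f).

(* 1 + q \sum_(n >= 1) coboundary (E_n) x ^ n / n! *)
Definition coboundary_series (R : realType) (A : {fset int}) :
    fps {poly {poly rat}} :=
  fun n => if n == 0%N then 1
           else 'X * coboundary (E_arr R A n) * ((n`!%:R^-1 : rat)%:P)%:P.

(* Main.v *)
(* Write a set B of hyperplanes x_i - x_j = a as a set of edges with integer
   gains; B is central iff it is balanced, i.e. has a potential. By Whitney's
   expansion t ^ k = sum of (t - 1) ^ |B| over the subsets B of a k-set, with
   c(B) the number of connected components of B,
     q * coboundary (E_n) = P_n(q) := \sum_(B balanced) q ^ c(B) (t - 1) ^ |B|,
   while the coefficient of A_r counts the potentials of B with values in [r].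
   Normalizing the potentials of B by the least natural one shows that, for r
   large in terms of n, the series A_(m + r) and P(m) * A_r agree up to x ^ n:
   on each component, a potential with values in [m + r] is either the least
   one plus a constant smaller than m, or m plus a potential with values in
   [r]. Hence A_r / A_(r-1) tends to P(1), and P(m) = P(1) ^ m for every natural
   m, which determines P(q) because its coefficients are polynomials in q. *)

Require Import Defs.
From HB Require Import structures.
From mathcomp Require Import all_boot all_order all_algebra finmap.
From mathcomp Require Import all_classical all_reals.
From mathcomp Require Import zify.

Set Implicit Arguments.
Unset Strict Implicit.
Unset Printing Implicit Defensive.

Import Order.TTheory GRing.Theory Num.Theory.

Local Open Scope fset_scope.
Local Open Scope classical_set_scope.
Local Open Scope ring_scope.

(** * Formal power series *)

Section FpsRing.
Context {K : comNzRingType}.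
Implicit Types f g h u : fps K.

(** Coefficients up to [n] only see truncations, so the ring laws for series below are inherited
    from polynomials. *)
Lemma fps_mulE N f g n : (n < N)%N ->
  fps_mul f g n = ((\poly_(i < N) f i) * (\poly_(i < N) g i))`_n.
Proof.
move=> nN; rewrite coefM; apply: eq_bigr => i _.
rewrite !coef_poly (leq_ltn_trans _ nN) ?(leq_ltn_trans _ nN) ?leq_subr //.
by rewrite -ltnS.
Qed.

Lemma fps_mulC f g : fps_mul f g = fps_mul g f.
Proof. by apply/funext => n; rewrite !(@fps_mulE n.+1) // mulrC. Qed.

Lemma fps_mulA f g h : fps_mul f (fps_mul g h) = fps_mul (fps_mul f g) h.
Proof.
apply/funext => n; pose tr (u : fps K) := \poly_(i < n.+1) u i.
have trE u i : (i <= n)%N -> u i = (tr u)`_i by move=> ?; rewrite coef_poly ltnS ifT.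
transitivity ((tr f * (tr g * tr h))`_n).
  rewrite coefM; apply: eq_bigr => i _.
  by rewrite (fps_mulE _ _ (_ : _ < n.+1)%N) ?ltnS ?leq_subr // trE // -ltnS.
rewrite mulrA coefM; apply: eq_bigr => i _.
by rewrite (fps_mulE _ _ (_ : _ < n.+1)%N) // -trE // leq_subr.
Qed.

Lemma fps_mul1 f : fps_mul (@fps_one K) f = f.
Proof.
apply/funext => n; rewrite /fps_mul big_ord_recl /fps_one eqxx mul1r subn0.
by rewrite big1 ?addr0 // => i _; rewrite mul0r.
Qed.

Lemma fps_mulr1 f : fps_mul f (@fps_one K) = f.
Proof. by rewrite fps_mulC fps_mul1. Qed.

Lemma fps_mul_eq f f' g g' n :
    (forall i, (i <= n)%N -> f i = f' i) -> (forall i, (i <= n)%N -> g i = g' i) ->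
  fps_mul f g n = fps_mul f' g' n.
Proof.
move=> ff' gg'; apply: eq_bigr => i _.
by rewrite ff' ?gg' ?leq_subr // -ltnS.
Qed.

Lemma fps_mulDl f g h :
  fps_mul (fun n => f n + g n) h = fun n => fps_mul f h n + fps_mul g h n.
Proof.
apply/funext => n; rewrite /fps_mul -big_split.
by apply: eq_bigr => i _; rewrite mulrDl.
Qed.

Lemma fps_mulZl c f g :
  fps_mul (fun n => c * f n) g = fun n => c * fps_mul f g n.
Proof.
apply/funext => n; rewrite /fps_mul mulr_sumr.
by apply: eq_bigr => i _; rewrite mulrA.
Qed.

Lemma fps_pow_small u m n : u 0%N = 0 -> (n < m)%N -> fps_pow u m n = 0.
Proof.
move=> u0; elim: m n => // m IHm n nm; rewrite /= /fps_mul big1 // => -[i /= lein] _.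
case: i lein => [|i] lein; first by rewrite u0 mul0r.
by rewrite IHm ?mulr0 // ltn_subLR // ?addSn; lia.
Qed.

Lemma fps_substE N c u n : u 0%N = 0 -> (n < N)%N ->
  fps_subst c u n = \sum_(m < N) c m * fps_pow u m n.
Proof.
move=> u0 nN; rewrite /fps_subst.
rewrite (big_ord_widen _ (fun m => c m * fps_pow u m n) nN) big_mkcond /=.
apply: eq_bigr => i _; case: ltnP => // lt.
by rewrite fps_pow_small ?mulr0 // u0.
Qed.

Lemma fps_subst0 c u : fps_subst c u 0%N = c 0%N.
Proof. by rewrite /fps_subst big_ord1 /= /fps_one eqxx mulr1. Qed.

(** With [f = 1 + u], multiplying the alternating sum of the powers of [u] by [1 + u] telescopes. *)
Lemma fps_mul_invr f : f 0%N = 1 -> fps_mul f (fps_inv f) = @fps_one K.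
Proof.
move=> f0; set u := fps_sub f (@fps_one K).
have u0 : u 0%N = 0 by rewrite /u /fps_sub f0 /fps_one subrr.
have -> : f = (fun n => @fps_one K n + u n).
  by apply/funext => n; rewrite /u /fps_sub addrCA subrr addr0.
rewrite fps_mulDl fps_mul1; apply/funext => n.
have -> : (fun n => @fps_one K n + u n) = f.
  by apply/funext => i; rewrite /u /fps_sub addrCA subrr addr0.
rewrite /fps_inv -/u.
have -> : fps_mul u (fps_subst (fun m => (-1) ^+ m) u) n =
    \sum_(m < n.+1) (-1) ^+ m * fps_pow u m.+1 n.
  under [RHS]eq_bigr => m _ do rewrite /= /fps_mul mulr_sumr.
  rewrite exchange_big; apply: eq_bigr => i _ /=.
  rewrite (@fps_substE n.+1) ?ltnS ?leq_subr // mulr_sumr.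
  by apply: eq_bigr => m _; rewrite mulrCA.
(* The bound [n.+2] includes one vanishing term: once [m = 0] is split off, the other [n.+1] terms
   cancel those of [u] times the series. *)
rewrite (@fps_substE n.+2) // big_ord_recl expr0 mul1r /= -addrA -big_split /=.
rewrite big1 ?addr0 // => m _.
by rewrite /bump /= exprS mulN1r mulNr addNr.
Qed.

Lemma fps_mulrK f g : g 0%N = 1 -> fps_div (fps_mul f g) g = f.
Proof.
by move=> g0; rewrite /fps_div -fps_mulA fps_mul_invr // fps_mulr1.
Qed.

(** Multiplying by the inverse of [h] cancels it, and coefficient [n] of a product only reads
    coefficients up to [n]. This suits the shift identity for [A_series], which holds only up to a
    given degree. *)
Lemma fps_mulIr_trunc f g h n : h 0%N = 1 ->
    (forall i, (i <= n)%N -> fps_mul f h i = fps_mul g h i) -> f n = g n.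
Proof.
move=> h0 e; rewrite -(fps_mulrK f h0) -(fps_mulrK g h0).
exact: fps_mul_eq.
Qed.

Definition fps_deriv f : fps K := fun n => f n.+1 *+ n.+1.

Lemma fps_derivM f g : fps_deriv (fps_mul f g) =
  fun n => fps_mul (fps_deriv f) g n + fps_mul f (fps_deriv g) n.
Proof.
apply/funext => n; pose tr (u : fps K) := \poly_(i < n.+2) u i.
have trE u i : (i <= n)%N -> fps_deriv u i = ((tr u)^`())`_i.
  by move=> ?; rewrite coef_deriv coef_poly !ltnS ifT.
have tr0 u i : (i <= n)%N -> u i = (tr u)`_i.
  by move=> ?; rewrite coef_poly ltnS ifT // leqW.
rewrite {1}/fps_deriv (@fps_mulE n.+2) // -coef_deriv derivM coefD !coefM.
congr (_ + _); apply: eq_bigr => i _; rewrite -trE -?tr0 ?leq_subr // -ltnS //.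
Qed.

Lemma fps_deriv_pow u m : fps_deriv (fps_pow u m.+1) =
  fun n => fps_mul (fps_pow u m) (fps_deriv u) n *+ m.+1.
Proof.
elim: m => [|m IHm].
  by rewrite /= fps_mulr1 fps_mul1; apply/funext => n; rewrite mulr1n.
rewrite [fps_pow u m.+2]/= fps_derivM; apply/funext => n.
rewrite IHm fps_mulC -/(fps_pow u m.+1) [in RHS]mulrS; congr (_ + _).
have -> : (fun n => fps_mul (fps_pow u m) (fps_deriv u) n *+ m.+1) =
  fun n => m.+1%:R * fps_mul (fps_pow u m) (fps_deriv u) n.
  by apply/funext => i; rewrite mulr_natl.
by rewrite fps_mulC fps_mulZl mulr_natl [fps_mul _ u]fps_mulC fps_mulA.
Qed.

Lemma fps_deriv_subst c u : u 0%N = 0 -> fps_deriv (fps_subst c u) =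
  fps_mul (fps_subst (fps_deriv c) u) (fps_deriv u).
Proof.
move=> u0; apply/funext => n; rewrite {1}/fps_deriv /fps_subst.
rewrite big_ord_recl /= /fps_one /= mulr0 add0r -sumrMnl.
transitivity (\sum_(m < n.+1) fps_deriv c m * fps_mul (fps_pow u m) (fps_deriv u) n).
  apply: eq_bigr => m _; rewrite /bump /= -mulrnAr.
  rewrite -[_ *+ n.+1]/(fps_deriv (fps_pow u m.+1) n) fps_deriv_pow.
  by rewrite mulrnAr mulrnAl.
under eq_bigr => m _ do rewrite /fps_mul mulr_sumr.
rewrite exchange_big; apply: eq_bigr => i _ /=.
rewrite -/(fps_subst (fps_deriv c) u i) (@fps_substE n.+1) // mulr_suml.
by apply: eq_bigr => m _; rewrite mulrA.
Qed.

End FpsRing.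

(** * Differential equations of the exponential, the logarithm and powers *)

Section FpsPow.
Context {K : idomainType}.
Hypothesis natU : forall n, n.+1%:R \is a @GRing.unit K.
Implicit Types f g : fps K.

Lemma fps_deriv_exp g : g 0%N = 0 ->
  fps_deriv (fps_exp g) = fps_mul (fps_deriv g) (fps_exp g).
Proof.
move=> g0; rewrite /fps_exp fps_deriv_subst // fps_mulC; congr fps_mul.
congr fps_subst; apply/funext => m; rewrite /fps_deriv -[LHS]mulr_natr.
have fU k : k`!%:R \is a @GRing.unit K.
  by elim: k => [|k IHk]; rewrite ?unitr1 // factS natrM unitrM natU.
by rewrite factS natrM invrM // mulrVK.
Qed.

(** The derived coefficients of the logarithm are those of the geometric series defining
    [fps_inv f]. *)
Lemma fps_mul_deriv_log f : f 0%N = 1 ->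
  fps_mul f (fps_deriv (fps_log f)) = fps_deriv f.
Proof.
move=> f0; rewrite /fps_log fps_deriv_subst ?/fps_sub ?f0 ?subrr //.
have -> : fps_deriv (fun m => (-1) ^+ m.+1 * m%:R^-1 : K) = (fun m => (-1) ^+ m).
  apply/funext => m; rewrite /fps_deriv -[LHS]mulr_natr -mulrA mulVr // mulr1.
  by rewrite !exprS !mulN1r opprK.
rewrite fps_mulA fps_mul_invr // fps_mul1.
by apply/funext => n; rewrite /fps_deriv /= subr0.
Qed.

(** The equation is the one satisfied by [f ^ c]. As [f] has constant term 1, coefficient [n] of the
    equation expresses [n.+1] times coefficient [n.+1] of a solution through earlier ones, and
    [n.+1] is invertible. *)
Lemma fps_ode_unique f c y z : f 0%N = 1 -> y 0%N = z 0%N ->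
    fps_mul f (fps_deriv y) = (fun n => c * fps_mul (fps_deriv f) y n) ->
    fps_mul f (fps_deriv z) = (fun n => c * fps_mul (fps_deriv f) z n) ->
  y = z.
Proof.
move=> f0 yz0 odey odez; apply/funext => n; have [k] := ubnP n.
elim: k n => // k IHk [//|n]; rewrite ltnS => nk.
have E (u : fps K) : fps_mul f (fps_deriv u) n =
    u n.+1 *+ n.+1 + \sum_(i < n) f i.+1 * fps_deriv u (n - i.+1)%N.
  by rewrite /fps_mul big_ord_recl f0 mul1r subn0.
have /eqP : fps_mul f (fps_deriv y) n = fps_mul f (fps_deriv z) n.
  rewrite odey odez; congr (_ * _); apply: eq_bigr => i _.
  by rewrite IHk // (leq_ltn_trans (leq_subr _ _)).
rewrite !E; have -> : \sum_(i < n) f i.+1 * fps_deriv y (n - i.+1)%N =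
   \sum_(i < n) f i.+1 * fps_deriv z (n - i.+1)%N.
  apply: eq_bigr => i _; rewrite /fps_deriv IHk //.
  by have := ltn_ord i; lia.
by move=> /eqP/addIr e; apply: (mulIr (natU n)); rewrite !mulr_natr.
Qed.

End FpsPow.

Lemma polyC_natU (K : idomainType) :
  (forall n, n.+1%:R \is a @GRing.unit K) ->
  forall n, n.+1%:R \is a @GRing.unit {poly K}.
Proof. by move=> natU n; rewrite -polyC_natr rmorph_unit. Qed.

(** * Powers with an indeterminate exponent *)

Section FpsPowq.
Context {K : idomainType}.
Hypothesis natU : forall n, n.+1%:R \is a @GRing.unit K.

(** Invertibility of the positive integers makes the naturals pairwise distinct in [K], so [p - q]
    has more roots than its degree allows. *)
Lemma poly_eq_on_nat (p q : {poly K}) :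
  (forall m : nat, p.[m%:R] = q.[m%:R]) -> p = q.
Proof.
move=> pq; apply/eqP; rewrite -subr_eq0; apply/eqP.
pose s := [seq (m%:R : K) | m <- iota 0 (size (p - q))].
have nat_inj m k : m%:R = k%:R :> K -> m = k.
  wlog mk : m k / (m <= k)%N.
    by move=> W; case: (leqP m k) => [/W //|/ltnW /W W' /esym /W'].
  move=> /eqP; rewrite eq_sym -subr_eq0 -natrB //.
  case E: (k - m)%N => [|d]; first by move=> _; apply/eqP; rewrite eqn_leq mk -subn_eq0 E.
  by move/eqP => d0; have := natU d; rewrite d0 unitr0.
apply: (@roots_geq_poly_eq0 _ _ s); last by rewrite size_map size_iota.
  by apply/allP => _ /mapP[m _ ->]; rewrite rootE hornerD hornerN pq subrr.
by rewrite map_inj_uniq ?iota_uniq.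
Qed.

(** Both sides have constant term 1 and solve [F y' = q F' y]. For [Y] this is tested at every
    natural [q = m], where it is the power rule for [F ^ m]; for [exp (q log F)] it follows from
    [F (log F)' = F']. *)
Lemma fps_powqP (F : fps K) (Y : fps {poly K}) : F 0%N = 1 ->
    (forall m n, (Y n).[m%:R] = fps_pow F m n) ->
  Y = fps_powq F.
Proof.
move=> F0 YE; pose G : fps {poly K} := fun n => (F n)%:P.
have polyCM (f g : fps K) : fps_mul (fun n => (f n)%:P) (fun n => (g n)%:P) =
    (fun n => (fps_mul f g n)%:P).
  apply/funext => n; rewrite /fps_mul raddf_sum.
  by apply: eq_bigr => i _ /=; rewrite polyCM.
have derivG (f : fps K) : fps_deriv (fun n => (f n)%:P) = (fun n => (fps_deriv f n)%:P).
  by apply/funext => n; rewrite /fps_deriv raddfMn.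
have log0 : fps_log F 0%N = 0 by rewrite /fps_log fps_subst0 invr0 mulr0.
apply: (@fps_ode_unique _ (polyC_natU natU) G 'X).
- by rewrite /G F0.
- rewrite /fps_powq /fps_exp fps_subst0 invr1; apply: poly_eq_on_nat => m.
  rewrite YE hornerC; elim: m => [|m IHm]; first by rewrite /= /fps_one eqxx.
  by rewrite /= /fps_mul big_ord1 F0 mul1r.
- apply/funext => n; apply: poly_eq_on_nat => m; rewrite hornerM hornerX.
  transitivity (fps_mul F (fps_deriv (fps_pow F m)) n).
    rewrite /fps_mul horner_sum; apply: eq_bigr => i _.
    by rewrite hornerM hornerC /fps_deriv hornerMn YE.
  transitivity (m%:R * fps_mul (fps_deriv F) (fps_pow F m) n); last first.
    congr (_ * _); rewrite /fps_mul horner_sum; apply: eq_bigr => i _.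
    by rewrite hornerM /G derivG hornerC YE.
  case: m => [|m].
    rewrite mul0r /fps_mul big1 // => i _.
    by rewrite /fps_deriv /= /fps_one mul0rn mulr0.
  rewrite fps_deriv_pow mulr_natl.
  have -> : (fun n => fps_mul (fps_pow F m) (fps_deriv F) n *+ m.+1) =
      fun n => m.+1%:R * fps_mul (fps_pow F m) (fps_deriv F) n.
    by apply/funext => i; rewrite mulr_natl.
  rewrite [fps_mul F _]fps_mulC fps_mulZl mulr_natl; congr (_ *+ _).
  suff -> : fps_mul (fps_mul (fps_pow F m) (fps_deriv F)) F =
      fps_mul (fps_deriv F) (fps_pow F m.+1) by [].
  by rewrite (fps_mulC _ F) fps_mulA (fps_mulC _ (fps_deriv F)).
- rewrite /fps_powq fps_deriv_exp ?log0 ?mulr0 //; last exact: polyC_natU.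
  rewrite fps_mulA -fps_mulZl; congr fps_mul.
  have -> : fps_deriv (fun n => 'X * (fps_log F n)%:P) =
      fun n => 'X * fps_deriv (fun n => (fps_log F n)%:P) n.
    by apply/funext => n; rewrite /fps_deriv mulrnAr.
  rewrite fps_mulC fps_mulZl derivG fps_mulC polyCM fps_mul_deriv_log //.
  by rewrite /G derivG.
Qed.

End FpsPowq.

(** * Sums over sets of edges *)

(** Expand the product over all [i] of [y + 1] for [i] in [X] and [0 + 1] elsewhere. *)
Lemma sum_subsets (K : comNzRingType) (T : finType) (X : {set T}) (y : K) :
  \sum_(B : {set T} | B \subset X) y ^+ #|B| = (1 + y) ^+ #|X|.
Proof.
have <- : \prod_i ((if i \in X then y else 0) + 1) = (1 + y) ^+ #|X|.
  rewrite -prodr_const [RHS]big_mkcond; apply: eq_bigr => i _.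
  by case: ifP => _; rewrite ?add0r // addrC.
rewrite bigA_distr big_mkcond; apply: eq_bigr => B _.
case: ifPn => [/fintype.subsetP BX|/fintype.subsetPn[i iB iX]].
  rewrite -prodr_const big_mkcond; apply: eq_bigr => i _.
  by case: ifP => // iB; rewrite BX.
by rewrite (bigD1 i) //= iB (negbTE iX) mul0r.
Qed.

Lemma sum_subsetsU (K : pzSemiRingType) (T : finType) (X Y : {set T})
    (F G : {set T} -> K) : [disjoint X & Y]%B ->
  \sum_(B : {set T} | B \subset X :|: Y) F (B :&: X) * G (B :&: Y) =
  (\sum_(B : {set T} | B \subset X) F B) * (\sum_(B : {set T} | B \subset Y) G B).
Proof.
move=> dXY; rewrite big_distrlr /= pair_big /=.
have I1 (B C : {set T}) : B \subset X -> C \subset Y -> (B :|: C) :&: X = B.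
  move=> BX CY; rewrite finset.setIUl (finset.setIidPl BX).
  suff -> : C :&: X = finset.set0 by rewrite finset.setU0.
  by apply/disjoint_setI0; rewrite disjoint_sym (disjointWr CY).
have I2 (B C : {set T}) : B \subset X -> C \subset Y -> (B :|: C) :&: Y = C.
  move=> BX CY; rewrite finset.setIUl (finset.setIidPl CY).
  suff -> : B :&: Y = finset.set0 by rewrite finset.set0U.
  by apply/disjoint_setI0; rewrite (disjointWl BX).
rewrite (reindex_onto (fun p : {set T} * {set T} => p.1 :|: p.2)
  (fun B => (B :&: X, B :&: Y))) /=; last first.
  by move=> B BXY; rewrite -finset.setIUr (finset.setIidPl BXY).
apply: eq_big => [[B C]|[B C]] /=; last first.
  by case/andP=> _ /eqP[-> ->].
apply/andP/andP => [[_ /eqP[<- <-]]|[BX CY]]; first by rewrite !subsetIr.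
by rewrite finset.setUSS // I1 // I2.
Qed.

Lemma sum_subsets_imset (K : nmodType) (T T' : finType) (phi : T -> T')
    (X : {set T}) (F : {set T'} -> K) : injective phi ->
  \sum_(B : {set T'} | B \subset phi @: X) F B =
  \sum_(B : {set T} | B \subset X) F (phi @: B).
Proof.
move=> phi_inj.
rewrite -(big_imset (A := [pred B : {set T} | B \subset X])) /=; last first.
  by move=> B C _ _; exact: imset_inj.
apply: eq_bigl => B; apply/idP/imsetP => [BX|[C CX ->]]; last exact: imsetS.
exists (X :&: (phi @^-1: B)); first by rewrite inE subsetIl.
apply/setP => x; apply/idP/imsetP => [xB|[z]]; last by rewrite !inE => /andP[_ ?] ->.
by have /imsetP[z zX xz] := fintype.subsetP BX x xB; exists z; rewrite // !inE zX -xz.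
Qed.

(** * Gain graphs, balanced edge sets and their potentials *)

Section Counting.
Variable A : {fset int}.

Definition edge n := ('I_n * 'I_n * A)%type.

Definition gain n (e : edge n) : int := fsval e.2.

Definition edges n : {set edge n} := [set e : edge n | (e.1.1 < e.1.2)%N]%SET.

Definition potential n (B : {set edge n}) (p : 'I_n -> int) : Prop :=
  forall e, e \in B -> p e.1.1 - p e.1.2 = gain e.

Definition balanced n (B : {set edge n}) : Prop := exists p, potential B p.

Definition fun_edges n r (f : {ffun 'I_n -> 'I_r}) : {set edge n} :=
  [set e in edges n | (f e.1.1 : nat)%:Z - (f e.1.2 : nat)%:Z == gain e]%SET.

Definition level_edges n m (g : {ffun 'I_n -> 'I_m}) : {set edge n} :=
  [set e in edges n | g e.1.1 == g e.1.2]%SET.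

(** The value [P_n(m)]. Colorings in place of the factor [m ^ c(B)] allow gluing with functions to
    [[r]] vertex by vertex; [balanced_sumE] recovers that factor. *)
Definition balanced_sum n m : {poly rat} :=
  \sum_(g : {ffun 'I_n -> 'I_m})
    \sum_(B : {set edge n} | (B \subset level_edges g) && `[< balanced B >])
      ('X - 1) ^+ #|B|.

(** The endpoints of an edge of [fun_edges f] determine its gain, so projecting to pairs loses
    nothing. *)
Lemma card_fun_edges n r (f : {ffun 'I_n -> 'I_r}) : #|fun_edges f| = a_stat A f.
Proof.
have inj : {in fun_edges f &, injective (fun e : edge n => e.1)}.
  move=> [x a] [y b] /=; rewrite !inE /= => /andP[_ /eqP ha] /andP[_ /eqP hb] xy.
  by move: ha; rewrite xy hb /gain /= => /val_inj ->.
rewrite -(card_in_imset inj); apply: eq_card => p; rewrite [RHS]inE.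
apply/imsetP/andP => [[[x a]]|[lt pA]].
  rewrite !inE /= => /andP[xlt /eqP xa] ->.
  by rewrite xa /gain; split => //; exact: fsvalP.
by exists (p, [` pA]); rewrite // !inE /gain /= lt /=.
Qed.

Lemma sum_a_stat n r : \sum_(f : {ffun 'I_n -> 'I_r}) 'X^(a_stat A f) =
  \sum_(f : {ffun 'I_n -> 'I_r})
    \sum_(B : {set edge n} | B \subset fun_edges f) ('X - 1) ^+ #|B| :> {poly rat}.
Proof.
by apply: eq_bigr => f _; rewrite sum_subsets addrC subrK card_fun_edges.
Qed.

Lemma balanced_nat n (B : {set edge n}) : balanced B ->
  exists p : 'I_n -> nat, potential B (fun i => (p i)%:Z).
Proof.
case=> p pB; pose s : int := \sum_i `|p i|.
have s_ge i : `|p i| <= s.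
  by rewrite /s (bigD1 i) //= lerDl sumr_ge0.
exists (fun i => absz (p i + s)) => e eB; rewrite -(pB e eB).
by have := s_ge e.1.1; have := s_ge e.1.2; lia.
Qed.

(* Potentials are closed under pointwise minima, hence the least one exists. *)
Lemma least_potential n (B : {set edge n}) : balanced B ->
  exists2 p : 'I_n -> nat, potential B (fun i => (p i)%:Z) &
    forall p' : 'I_n -> nat, potential B (fun i => (p' i)%:Z) ->
      forall i, (p i <= p' i)%N.
Proof.
move=> /balanced_nat[p0 p0B].
have exm i : exists k, `[< exists2 p : 'I_n -> nat,
    potential B (fun i => (p i)%:Z) & p i = k >].
  by exists (p0 i); apply/asboolP; exists p0.
pose p i := ex_minn (exm i).
have pP i : exists2 p' : 'I_n -> nat, potential B (fun i => (p' i)%:Z) & p' i = p i.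
  by rewrite /p; case: ex_minnP => k /asboolP.
have p_le p' i : potential B (fun i => (p' i)%:Z) -> (p i <= p' i)%N.
  move=> p'B; rewrite /p; case: ex_minnP => k _; apply.
  by apply/asboolP; exists p'.
exists p => [e eB|p' p'B i]; last exact: p_le.
have [p1 p1B E1] := pP e.1.1; have [p2 p2B E2] := pP e.1.2.
have := p1B e eB; have := p2B e eB; have := p_le _ e.1.1 p2B; have := p_le _ e.1.2 p1B.
rewrite -E1 -E2; lia.
Qed.

(* A value [h i < m] encodes a color in [m], and a value [m + u] encodes the
   value [u] of a potential in [r]. *)
Definition mixed_edges n m r (h : {ffun 'I_n -> 'I_(m + r)}) : {set edge n} :=
  [set e in edges n | if (h e.1.1 < m)%N then h e.1.1 == h e.1.2
     else (m <= h e.1.2)%N && ((h e.1.1 : nat)%:Z - (h e.1.2 : nat)%:Z == gain e)]%SET.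

(* With [p] the least potential of [B], the difference [f - p] is nonnegative
   and constant along the edges of [B]; replacing [f] by [f - p] where the
   latter is smaller than [m] is the bijection. *)
Lemma card_mixed n m r (B : {set edge n}) (p : 'I_n -> nat) :
    B \subset edges n ->
    potential B (fun i => (p i)%:Z) ->
    (forall p' : 'I_n -> nat, potential B (fun i => (p' i)%:Z) ->
      forall i, (p i <= p' i)%N) ->
    (forall i, p i <= r)%N ->
  #|[set f : {ffun 'I_n -> 'I_(m + r)} | B \subset fun_edges f]%SET| =
  #|[set h : {ffun 'I_n -> 'I_(m + r)} | B \subset mixed_edges h]%SET|.
Proof.
move=> BE pB pmin pr.
have lowP (f : {ffun 'I_n -> 'I_(m + r)}) i : (f i - p i < m + r)%N.
  exact: leq_ltn_trans (leq_subr _ _) (ltn_ord _).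
pose to (f : {ffun 'I_n -> 'I_(m + r)}) : {ffun 'I_n -> 'I_(m + r)} :=
  [ffun i => if (f i - p i < m)%N then Ordinal (lowP f i) else f i].
have toE f i : (to f i = (if (f i - p i < m)%N then f i - p i else f i) :> nat)%N.
  by rewrite ffunE; case: ifP.
have sat (f : {ffun 'I_n -> 'I_(m + r)}) e : B \subset fun_edges f -> e \in B ->
    (f e.1.1 : nat)%:Z - (f e.1.2 : nat)%:Z = gain e.
  by move=> /fintype.subsetP H /H; rewrite inE => /andP[_ /eqP].
have ge (f : {ffun 'I_n -> 'I_(m + r)}) i : B \subset fun_edges f -> (p i <= f i)%N.
  by move=> fB; apply: (pmin (fun i => f i : nat)) => e; exact: sat.
have inj :
    {in [set f : {ffun 'I_n -> 'I_(m + r)} | B \subset fun_edges f]%SET &, injective to}.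
  move=> f f'; rewrite !inE => fB f'B ff'; apply/ffunP => i; apply/val_inj => /=.
  have := congr1 (fun u : {ffun _ -> 'I__} => (u i : nat)) ff'; rewrite /= !toE.
  move: (ge _ i fB) (ge _ i f'B).
  move: (nat_of_ord (f i)) (nat_of_ord (f' i)) (p i) => a b c.
  by case: ltnP => /= ?; case: ltnP => /= ?; lia.
rewrite -(card_in_imset inj); apply: eq_card => h; rewrite [RHS]inE.
apply/imsetP/idP => [[f]|hB].
  rewrite inE => fB ->; apply/fintype.subsetP => e eB.
  rewrite inE (fintype.subsetP BE) //=.
  have := sat _ _ fB eB; have := pB _ eB.
  have := ge _ e.1.1 fB; have := ge _ e.1.2 fB.
  rewrite -val_eqE /= !toE.
  move: (nat_of_ord (f e.1.1)) (nat_of_ord (f e.1.2)) (p e.1.1) (p e.1.2) (gain e).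
  move=> f1 f2 p1 p2 a h1 h2 h3 h4.
  have dd : (f1 - p1 = f2 - p2)%N by lia.
  rewrite -dd; case: (ltnP (f1 - p1) m) => c1; first by rewrite c1.
  by rewrite ifF; lia.
have mix e : e \in B -> if (h e.1.1 < m)%N then h e.1.1 = h e.1.2 :> nat
     else (m <= h e.1.2)%N /\ ((h e.1.1 : nat)%:Z - (h e.1.2 : nat)%:Z = gain e).
  move=> /(fintype.subsetP hB); rewrite inE => /andP[_].
  by case: ifP => _; [move/eqP-> | move=> /andP[? /eqP]].
(* On the high vertices [h - m] satisfies the potential equations; completed by [p] on the low ones
   it is a potential of all of [B], since no edge of [B] joins the two kinds. Minimality of [p] then
   applies. *)
have p_high i : (m <= h i -> p i <= h i - m)%N.
  pose p' i := (if (h i < m)%N then p i else h i - m)%N.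
  move=> hi; suff /pmin/(_ i) : potential B (fun i => (p' i)%:Z) by rewrite /p' ltnNge hi.
  move=> e eB; have := mix e eB; have := pB e eB; rewrite /p'.
  move: (nat_of_ord (h e.1.1)) (nat_of_ord (h e.1.2)) (p e.1.1) (p e.1.2) (gain e).
  move=> h1 h2 p1 p2 a pe; case: (ltnP h1 m) => c1; first by move=> e12; rewrite ifT; lia.
  by case=> c2 e12; rewrite ifF; lia.
(* Here [p i <= r] keeps [h i + p i] below [m + r]. *)
have addP i : ((if h i < m then h i + p i else h i) < m + r)%N.
  by case: ifP => // hm; have := pr i; lia.
pose f : {ffun 'I_n -> 'I_(m + r)} := [ffun i => Ordinal (addP i)].
have fE i : (f i = (if (h i < m)%N then h i + p i else h i) :> nat)%N by rewrite ffunE.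
exists f.
  rewrite inE; apply/fintype.subsetP => e eB; rewrite inE (fintype.subsetP BE) //= !fE.
  have := mix e eB; have := pB e eB.
  move: (nat_of_ord (h e.1.1)) (nat_of_ord (h e.1.2)) (p e.1.1) (p e.1.2) (gain e).
  move=> h1 h2 p1 p2 a pe; case: (ltnP h1 m) => c1; first by move=> e12; rewrite ifT; lia.
  by case=> c2 e12; rewrite ifF; lia.
apply/ffunP => i; apply/val_inj; rewrite /= toE fE.
case: (ltnP (h i) m) => hi; first by rewrite addnK hi.
by have := p_high i hi; case: ltnP => //; lia.
Qed.

(** After exchanging the sums, each [B] is weighted by a number of functions, and [card_mixed]
    equates these numbers for balanced [B] inside [edges n]. An unbalanced [B] lies in no
    [fun_edges f]. *)
Lemma mixed_sum n : exists N, forall m r, (N <= r)%N ->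
  \sum_(f : {ffun 'I_n -> 'I_(m + r)})
    \sum_(B : {set edge n} | B \subset fun_edges f) ('X - 1) ^+ #|B| =
  \sum_(h : {ffun 'I_n -> 'I_(m + r)})
    \sum_(B : {set edge n} | (B \subset mixed_edges h) && `[< balanced B >])
      ('X - 1) ^+ #|B| :> {poly rat}.
Proof.
have /choice[p pP] : forall B : {set edge n}, exists p : 'I_n -> nat, balanced B ->
    potential B (fun i => (p i)%:Z) /\
    forall p' : 'I_n -> nat, potential B (fun i => (p' i)%:Z) ->
      forall i, (p i <= p' i)%N.
  move=> B; case: (pselect (balanced B)) => [/least_potential[p p1 p2]|nB].
    by exists p.
  by exists (fun=> 0%N).
(* Summing over all [B] and all vertices gives one bound for every edge set. *)
exists (\sum_B \sum_i p B i)%N => m r Nr.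
rewrite (exchange_big_dep predT) //= [RHS](exchange_big_dep predT) //=.
apply: eq_bigr => B _; rewrite !sumr_const; congr (_ *+ _).
have fun_balanced (f : {ffun 'I_n -> 'I_(m + r)}) : B \subset fun_edges f -> balanced B.
  move=> /fintype.subsetP fB; exists (fun i => (f i : nat)%:Z) => e /fB.
  by rewrite inE => /andP[_ /eqP].
case: (pselect (balanced B)) => [balB|nbalB]; last first.
  rewrite (asboolF nbalB) !eq_card0 // => f; rewrite unfold_in ?andbF //.
  by apply/negbTE/negP => fB; apply: nbalB; exact: fun_balanced fB.
have [BE|nBE] := boolP (B \subset edges n); last first.
  have sub_edges (P : pred (edge n)) :
      (B \subset [set e in edges n | P e]%SET) = false.
    apply: contraNF nBE => /fintype.subsetP BP; apply/fintype.subsetP => e /BP.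
    by rewrite inE => /andP[].
  by rewrite !eq_card0 // => f; rewrite unfold_in /= sub_edges.
have [pB pmin] := pP B balB.
have pr i : (p B i <= r)%N.
  by rewrite (leq_trans _ Nr) // (bigD1 B) //= (bigD1 i) //= -addnA leq_addr.
have := card_mixed m BE pB pmin pr; rewrite !cardsE => cm.
by rewrite [RHS](eq_card (B := [pred h | B \subset mixed_edges h])) => [|h];
  rewrite // !unfold_in (asboolT balB) andbT.
Qed.

(** * Splitting a mixed function into its low and high parts *)

Definition low_edges n m r (h : {ffun 'I_n -> 'I_(m + r)}) : {set edge n} :=
  [set e in edges n | (h e.1.1 < m)%N && (h e.1.1 == h e.1.2)]%SET.

Definition high_edges n m r (h : {ffun 'I_n -> 'I_(m + r)}) : {set edge n} :=
  [set e in edges n | [&& (m <= h e.1.1)%N, (m <= h e.1.2)%N &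
     (h e.1.1 : nat)%:Z - (h e.1.2 : nat)%:Z == gain e]]%SET.

Lemma mixed_edgesE n m r (h : {ffun 'I_n -> 'I_(m + r)}) :
  mixed_edges h = low_edges h :|: high_edges h.
Proof.
apply/setP => e; rewrite !inE -andb_orr; congr (_ && _).
by rewrite (leqNgt m (h e.1.1)); case: ltnP => //=; rewrite orbF.
Qed.

Lemma disjoint_low_high n m r (h : {ffun 'I_n -> 'I_(m + r)}) :
  [disjoint low_edges h & high_edges h]%B.
Proof.
rewrite -setI_eq0; apply/eqP/setP => e; rewrite !inE; apply/negP.
by case/andP => /and3P[_ h1 _] /and4P[_]; rewrite leqNgt h1.
Qed.

(** On the high edges [h] itself is a potential, and no mixed edge joins a low vertex to a high one,
    so a potential of the low part extends by [h]. *)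
Lemma balanced_low n m r (h : {ffun 'I_n -> 'I_(m + r)}) (B : {set edge n}) :
  B \subset mixed_edges h -> balanced B <-> balanced (B :&: low_edges h).
Proof.
move=> BM; split=> [[p pB]|[p pB]].
  by exists p => e; rewrite inE => /andP[/pB].
exists (fun i => if (h i < m)%N then p i else (h i : nat)%:Z) => e eB.
have := fintype.subsetP BM e eB; rewrite mixed_edgesE finset.in_setU => /orP[eL|].
  have := pB e; rewrite inE eB eL => /(_ isT) <-.
  by move: eL; rewrite !inE => /and3P[_ h1 /eqP <-]; rewrite h1.
by rewrite inE => /and4P[_ h1 h2 /eqP <-]; rewrite !ltnNge h1 h2.
Qed.

(** Balance constrains only the low part of [B]; the high part is an arbitrary subset and sums to a
    power of [t]. *)
Lemma mixed_sum_split n m r (h : {ffun 'I_n -> 'I_(m + r)}) :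
  \sum_(B : {set edge n} | (B \subset mixed_edges h) && `[< balanced B >])
    ('X - 1) ^+ #|B| =
  (\sum_(B : {set edge n} | (B \subset low_edges h) && `[< balanced B >])
    ('X - 1) ^+ #|B|) * 'X ^+ #|high_edges h| :> {poly rat}.
Proof.
rewrite -[X in X ^+ #|high_edges h|](subrK 1) (addrC _ 1) -sum_subsets !big_mkcondr /=.
rewrite -(sum_subsetsU (fun B => if `[< balanced B >] then ('X - 1) ^+ #|B| else 0)
  (fun B => ('X - 1) ^+ #|B|)) ?disjoint_low_high // mixed_edgesE.
apply: eq_bigr => B; rewrite -mixed_edgesE => BM.
rewrite (asbool_equiv_eq (balanced_low BM)); case: ifP; rewrite ?mul0r // => _.
rewrite -exprD -cardsUI -finset.setIUr -mixed_edgesE (finset.setIidPl BM).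
suff -> : B :&: low_edges h :&: (B :&: high_edges h) = finset.set0.
  by rewrite cards0 addn0.
apply/eqP; rewrite setI_eq0.
by apply: disjointWl (subsetIr _ _) (disjointWr (subsetIr _ _) (disjoint_low_high h)).
Qed.

Definition relabel k n (s : 'I_k -> 'I_n) (e : edge k) : edge n :=
  (s e.1.1, s e.1.2, e.2).

Lemma relabel_inj k n (s : 'I_k -> 'I_n) : injective s -> injective (relabel s).
Proof. by move=> s_inj [[i j] a] [[i' j'] a'] [/s_inj -> /s_inj -> ->]. Qed.

Lemma balanced_relabel k n (s : 'I_k -> 'I_n) (B : {set edge k}) :
  injective s -> balanced (relabel s @: B) <-> balanced B.
Proof.
move=> s_inj; split=> [[p pB]|[p pB]].
  exists (p \o s) => e eB; exact: (pB (relabel s e) (imset_f _ eB)).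
(* The value 0 off the image of [s] is arbitrary: every edge of the relabelled set has both ends in
   the image. *)
exists (fun x => if [pick i | s i == x] is Some i then p i else 0).
move=> _ /imsetP[e eB ->]; rewrite -[gain _](pB e eB) /=.
have pickE i : [pick i' | s i' == s i] = Some i.
  by case: pickP => [i' /eqP/s_inj -> //|/(_ i)]; rewrite eqxx.
by rewrite !pickE.
Qed.

Section Glue.
Variables (n k l m r : nat) (s1 : 'I_k -> 'I_n) (s2 : 'I_l -> 'I_n).
Variable tau : 'I_n -> 'I_k + 'I_l.
Hypotheses (tau1 : forall i, tau (s1 i) = inl i) (tau2 : forall j, tau (s2 j) = inr j).
Hypothesis tauK : forall x, match tau x with inl i => s1 i | inr j => s2 j end = x.
Hypothesis s1_mono : forall i j, (s1 i < s1 j)%N = (i < j)%N.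
Hypothesis s2_mono : forall i j, (s2 i < s2 j)%N = (i < j)%N.

Let s1_inj : injective s1.
Proof. by move=> i j /(congr1 tau); rewrite !tau1 => -[]. Qed.

Let s2_inj : injective s2.
Proof. by move=> i j /(congr1 tau); rewrite !tau2 => -[]. Qed.

(** The maps [s1] and [s2] list complementary vertex sets, and [tau] inverts them jointly. They are
    increasing so that relabelling respects the orientation [i < j] of [edges]. *)
Definition glue (gf : {ffun 'I_k -> 'I_m} * {ffun 'I_l -> 'I_r}) :
    {ffun 'I_n -> 'I_(m + r)} :=
  [ffun x => match tau x with
     | inl i => lshift r (gf.1 i)
     | inr j => rshift m (gf.2 j)
     end].

Lemma glue1 gf i : glue gf (s1 i) = lshift r (gf.1 i).
Proof. by rewrite ffunE tau1. Qed.

Lemma glue2 gf j : glue gf (s2 j) = rshift m (gf.2 j).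
Proof. by rewrite ffunE tau2. Qed.

Lemma s1s2_split x : (exists i, x = s1 i) \/ (exists j, x = s2 j).
Proof. by rewrite -(tauK x); case: (tau x) => i; [left|right]; exists i. Qed.

Lemma glue_inj : injective glue.
Proof.
move=> [g f] [g' f'] e; congr pair; apply/ffunP => i.
  by have := congr1 (fun h : {ffun _ -> _} => h (s1 i)) e; rewrite !glue1 => /lshift_inj.
by have := congr1 (fun h : {ffun _ -> _} => h (s2 i)) e; rewrite !glue2 => /rshift_inj.
Qed.

Lemma low_glue gf : low_edges (glue gf) = relabel s1 @: level_edges gf.1.
Proof.
apply/setP => -[[x y] a]; rewrite !inE /=; apply/idP/imsetP => [|[[[i j] b]]]; last first.
  rewrite !inE /= => /andP[ij /eqP gij] [-> -> _].
  by rewrite s1_mono ij !glue1 /= ltn_ord gij eqxx.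
case/and3P => xy hx; case: (s1s2_split x) hx xy => -[i ->]; last first.
  by rewrite glue2 /= ltnNge leq_addr.
move=> _ iy; case: (s1s2_split y) iy => -[j ->]; last first.
  rewrite glue1 glue2 -val_eqE /= => _ /eqP e.
  by have := ltn_ord (gf.1 i); rewrite e ltnNge leq_addr.
rewrite s1_mono !glue1 => ij /eqP/lshift_inj gij.
by exists (i, j, a); rewrite // !inE /= ij gij eqxx.
Qed.

Lemma high_glue gf : high_edges (glue gf) = relabel s2 @: fun_edges gf.2.
Proof.
apply/setP => -[[x y] a]; rewrite !inE /=; apply/idP/imsetP => [|[[[i j] b]]]; last first.
  rewrite !inE /= => /andP[ij /eqP gij] [-> -> ->].
  rewrite s2_mono ij !glue2 /= !leq_addr -[gain _]gij /=.
  by rewrite !PoszD opprD addrACA subrr add0r eqxx.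
case/and4P => xy hx hy; case: (s1s2_split x) hx xy => -[i ->].
  by rewrite glue1 /= leqNgt ltn_ord.
case: (s1s2_split y) hy => -[j ->]; first by rewrite glue1 /= leqNgt ltn_ord.
rewrite s2_mono !glue2 /= => _ _ ij; rewrite !PoszD opprD addrACA subrr add0r => gij.
by exists (i, j, a); rewrite // !inE /= ij.
Qed.

(** A function whose low vertices form [S] is a glued pair: a coloring of [S] and a function to
    [[r]] on the complement. By [low_glue] and [high_glue] its weight factors accordingly. *)
Lemma glue_sum (S : {set 'I_n}) :
    (forall i, s1 i \in S) -> (forall j, s2 j \notin S) ->
  \sum_(h : {ffun 'I_n -> 'I_(m + r)} | [forall x, (h x < m)%N == (x \in S)])
    \sum_(B : {set edge n} | (B \subset mixed_edges h) && `[< balanced B >])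
      ('X - 1) ^+ #|B| =
  balanced_sum k m * (\sum_(f : {ffun 'I_l -> 'I_r}) 'X^(a_stat A f)) :> {poly rat}.
Proof.
move=> s1S s2S; rewrite /balanced_sum big_distrlr pair_big /=.
have E : forall h : {ffun 'I_n -> 'I_(m + r)},
    [forall x, (h x < m)%N == (x \in S)] = (h \in glue @: [set: _]%SET); last first.
  rewrite (eq_bigl _ _ E) big_imset /=; last by move=> ? ? _ _; exact: glue_inj.
  rewrite big_mkcond; apply: eq_bigr => -[g f] _; rewrite inE mixed_sum_split.
  rewrite low_glue high_glue (card_imset _ (relabel_inj s2_inj)) card_fun_edges.
  congr (_ * _); rewrite !big_mkcondr /= (sum_subsets_imset _ _ (relabel_inj s1_inj)).
  apply: eq_bigr => B _; rewrite (card_imset _ (relabel_inj s1_inj)).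
  by rewrite (asbool_equiv_eq (balanced_relabel B s1_inj)).
move=> h; apply/forallP/imsetP => [hS|[[g f] _ ->] x]; last first.
  case: (s1s2_split x) => -[i ->]; rewrite ?glue1 ?glue2 /=.
    by rewrite s1S ltn_ord.
  by rewrite (negbTE (s2S i)) ltnNge leq_addr.
have h1 i : (h (s1 i) < m)%N by rewrite (eqP (hS _)).
have h2 j : (m <= h (s2 j))%N by rewrite leqNgt (eqP (hS _)).
have h3 j : (h (s2 j) - m < r)%N by have := ltn_ord (h (s2 j)); have := h2 j; lia.
exists ([ffun i => Ordinal (h1 i)], [ffun j => Ordinal (h3 j)]); rewrite // ?inE //.
apply/ffunP => x; apply/val_inj; case: (s1s2_split x) => -[i ->].
  by rewrite glue1 /= ffunE.
by rewrite glue2 /= ffunE /= subnKC.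
Qed.

End Glue.

Lemma ex_mono_enum n (S : {set 'I_n}) k : #|S| = k ->
  exists s : 'I_k -> 'I_n,
    (forall i j, (s i < s j)%N = (i < j)%N) /\ (forall i, s i \in S).
Proof.
move=> <-; exists (@Order.enum_val _ _ (mem S)).
split=> [i j|i]; last exact: Order.enum_valP.
have := Order.le_enum_val (@Order.le_total _ 'I_n) (A := mem S) j i.
by rewrite !leEord => E; rewrite !ltnNge E.
Qed.

Lemma mono_inj k n (s : 'I_k -> 'I_n) :
  (forall i j, (s i < s j)%N = (i < j)%N) -> injective s.
Proof.
move=> s_mono i j e; apply/val_inj/eqP; rewrite /= eqn_leq.
by rewrite [(i <= j)%N]leqNgt [(j <= i)%N]leqNgt -!s_mono e ltnn.
Qed.

Lemma block_sum n m r (S : {set 'I_n}) :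
  \sum_(h : {ffun 'I_n -> 'I_(m + r)} | [forall x, (h x < m)%N == (x \in S)])
    \sum_(B : {set edge n} | (B \subset mixed_edges h) && `[< balanced B >])
      ('X - 1) ^+ #|B| =
  balanced_sum #|S| m *
    (\sum_(f : {ffun 'I_(n - #|S|) -> 'I_r}) 'X^(a_stat A f)) :> {poly rat}.
Proof.
have [s1 [s1_mono s1S]] := ex_mono_enum (erefl #|S|).
have cC : #|~: S| = (n - #|S|)%N by have := cardsC S; rewrite card_ord; lia.
have [s2 [s2_mono s2S]] := ex_mono_enum cC.
pose e (u : 'I_#|S| + 'I_(n - #|S|)) := match u with inl i => s1 i | inr j => s2 j end.
have e_inj : injective e.
  move=> [i|i] [j|j] /= eij.
  - by rewrite (mono_inj s1_mono eij).
  - by have := s2S j; rewrite -eij inE s1S.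
  - by have := s2S i; rewrite eij inE s1S.
  - by rewrite (mono_inj s2_mono eij).
have [|tau eK tauK] := inj_card_bij e_inj.
  by rewrite card_sum !card_ord subnKC // -[X in (_ <= X)%N]card_ord max_card.
apply: (@glue_sum _ _ _ _ _ s1 s2 tau) => //.
- by move=> i; exact: (eK (inl i)).
- by move=> i; exact: (eK (inr i)).
- by move=> j; have := s2S j; rewrite inE.
Qed.

Lemma sum_by_card n (K : nmodType) (Phi : nat -> K) :
  \sum_(S : {set 'I_n}) Phi #|S| = \sum_(k < n.+1) Phi k *+ 'C(n, k).
Proof.
have cS (S : {set 'I_n}) : (#|S| < n.+1)%N.
  by rewrite ltnS -[X in (_ <= X)%N]card_ord max_card.
rewrite (partition_big (fun S : {set 'I_n} => Ordinal (cS S)) predT) //=.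
apply: eq_bigr => k _.
have := card_draws 'I_n k; rewrite card_ord cardsE => <-; rewrite -sumr_const.
by apply: eq_big => S; rewrite -val_eqE //= => /eqP ->.
Qed.

(** Group the functions by their set [S] of low vertices. The value in [block_sum] depends only on
    the size of [S], and the binomial coefficient counting such sets yields a product of exponential
    generating functions. *)
Lemma A_series_shift n : exists N, forall m r, (N <= r)%N ->
  A_series A (m + r) n =
  fps_mul (fun k => (k`!%:R^-1 : rat) *: balanced_sum k m) (A_series A r) n.
Proof.
have [N NP] := mixed_sum n; exists N => m r Nr.
rewrite /A_series sum_a_stat (NP m r Nr).
rewrite (partition_big
  (fun h : {ffun 'I_n -> 'I_(m + r)} => [set x | (h x < m)%N]%SET) predT) //=.
pose Phi k := balanced_sum k m * (\sum_(f : {ffun 'I_(n - k) -> 'I_r}) 'X^(a_stat A f)).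
rewrite (eq_bigr (fun S : {set 'I_n} => Phi #|S|)) => [|S _]; last first.
  rewrite /Phi -block_sum; apply: eq_bigl => h.
  apply/eqP/forallP => [<- x|hS]; first by rewrite inE.
  by apply/setP => x; rewrite inE (eqP (hS x)).
rewrite sum_by_card scaler_sumr; apply: eq_bigr => k _.
rewrite -scalerAl -scalerAr scalerA /Phi -scaler_nat scalerA; congr (_ *: _).
have kn : (k <= n)%N by rewrite -ltnS.
have fn0 j : (j`!%:R : rat) != 0 by rewrite pnatr_eq0 -lt0n fact_gt0.
rewrite -(bin_fact kn) !natrM !invfM.
have b0 : ('C(n, k)%:R : rat) != 0 by rewrite pnatr_eq0 -lt0n bin_gt0.
by rewrite mulrAC mulVf // mul1r.
Qed.

(** * Connected components of an edge set *)

Definition edge_const n T (B : {set edge n}) (g : 'I_n -> T) : Prop :=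
  forall e, e \in B -> g e.1.1 = g e.1.2.

Definition adj n (B : {set edge n}) : rel 'I_n :=
  fun x y => [exists e in B, (e.1 == (x, y)) || (e.1 == (y, x))].

Definition ncomp n (B : {set edge n}) : nat := #|roots (adj B)|.

(** Here [rho] sends a vertex to its component and [s] picks representatives. The target [T] is
    arbitrary because the factorization serves both finite colorings and real vectors. *)
Lemma componentsP n (B : {set edge n}) :
  exists (rho : 'I_n -> 'I_(ncomp B)) (s : 'I_(ncomp B) -> 'I_n),
    [/\ cancel s rho, edge_const B rho &
      forall T (g : 'I_n -> T), edge_const B g -> forall x, g x = g (s (rho x))].
Proof.
have adj_sym : connect_sym (adj B).
  apply: sym_connect_sym => x y.
  by apply/existsP/existsP => -[e /andP[eB e12]]; exists e; rewrite eB orbC.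
pose rt := fingraph.root (adj B).
have rtP x : rt x \in roots (adj B) by exact: roots_root.
exists (fun x => enum_rank_in (rtP x) (rt x)), enum_val; split.
- move=> i; apply: enum_val_inj; rewrite enum_rankK_in //.
  by apply/eqP; exact: (enum_valP i).
- move=> e eB; apply: enum_val_inj; rewrite !enum_rankK_in //.
  apply/(fingraph.rootP adj_sym); apply: connect1; apply/existsP; exists e.
  by rewrite eB -surjective_pairing eqxx.
- move=> T g gB x; rewrite enum_rankK_in //.
  have /connectP[p] := connect_root (adj B) x; rewrite -/rt => + ->.
  elim: p x => //= y p IHp x /andP[/existsP[e /andP[eB exy]] /IHp <-].
  have := gB e eB.
  by case/orP: exy => /eqP ->.
Qed.

Lemma card_edge_const n (T : finType) (B : {set edge n}) :
  #|[set g : {ffun 'I_n -> T} | `[< edge_const B g >]]%SET| = (#|T| ^ ncomp B)%N.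
Proof.
have [rho [s [sK rhoB constB]]] := componentsP B.
pose lift_rho (u : {ffun 'I_(ncomp B) -> T}) : {ffun 'I_n -> T} := [ffun x => u (rho x)].
have lift_inj : injective lift_rho.
  move=> u v /ffunP uv; apply/ffunP => i; have := uv (s i).
  by rewrite !ffunE sK.
rewrite -[in RHS](card_ord (ncomp B)) -card_ffun -[RHS](card_imset _ lift_inj).
apply: eq_card => g; rewrite inE; apply/asboolP/imsetP => [gB|[u _ ->] e eB].
  exists [ffun i => g (s i)] => //; apply/ffunP => x; rewrite !ffunE.
  exact: constB.
by rewrite !ffunE rhoB.
Qed.

Lemma ncomp_le n (B : {set edge n}) : (ncomp B <= n)%N.
Proof. by rewrite -[X in (_ <= X)%N]card_ord max_card. Qed.

Lemma ncomp_gt0 n (B : {set edge n}) : (0 < n)%N -> (0 < ncomp B)%N.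
Proof.
have [rho _] := componentsP B.
by move=> n_gt0; case: (rho (Ordinal n_gt0)) => i /(leq_ltn_trans _) ->.
Qed.

(** A star centered at vertex 0 with all gains equal to [a] has no cycle, hence is balanced, and it
    reaches every vertex. It witnesses the rank of the arrangement. *)
Lemma ncomp_star n (a : A) :
  exists B : {set edge n.+1},
    [/\ B \subset edges n.+1, balanced B & ncomp B = 1%N].
Proof.
exists [set e : edge n.+1 | [&& e.1.1 == ord0, (0 < e.1.2)%N & e.2 == a]]%SET.
set B := finset _; split.
- by apply/fintype.subsetP => e; rewrite !inE => /and3P[/eqP-> ].
- exists (fun i => if i == ord0 then 0 else - fsval a) => -[[x y] b].
  rewrite inE /= => /and3P[/eqP-> y_gt0 /eqP->]; rewrite eqxx ifF ?sub0r ?opprK //.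
  by apply/negbTE; rewrite -val_eqE /= -lt0n.
- have [rho [s [sK rhoB _]]] := componentsP B.
  have rho0 x : rho x = rho ord0.
    have [->//|x0] := eqVneq x ord0.
    have /(_ (ord0, x, a)) /= -> // := rhoB.
    by rewrite inE /= !eqxx andbT lt0n.
  apply/eqP; rewrite eqn_leq ncomp_gt0 // andbT -[ncomp B]card_ord.
  by apply/card_le1_eqP => i j _ _; rewrite -[i]sK -[j]sK rho0 [RHS]rho0.
Qed.

(** Exchange the sums and count, for each [B], the colorings constant along its edges. *)
Lemma balanced_sumE n m : balanced_sum n m =
  \sum_(B : {set edge n} | (B \subset edges n) && `[< balanced B >])
    ('X - 1) ^+ #|B| *+ m ^ ncomp B.
Proof.
rewrite /balanced_sum (exchange_big_dep predT) //= [RHS]big_mkcond /=.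
apply: eq_bigr => B _; rewrite sumr_const.
have levelE (g : {ffun 'I_n -> 'I_m}) : (B \subset level_edges g) =
    (B \subset edges n) && `[< edge_const B g >].
  apply/fintype.subsetP/andP => [H|[/fintype.subsetP BE /asboolP gB] e eB].
    split; first by apply/fintype.subsetP => e /H; rewrite inE => /andP[].
    by apply/asboolP => e /H; rewrite inE => /andP[_ /eqP].
  by rewrite inE BE //= gB.
case: ifP => [/andP[BE balB]|nB].
  rewrite -[in RHS](card_ord m) -card_edge_const; congr (_ *+ _).
  by rewrite cardsE; apply: eq_card => g; rewrite !unfold_in levelE BE balB andbT.
rewrite (_ : #|_| = 0%N) ?mulr0n //; apply: eq_card0 => g.
by rewrite unfold_in /= levelE -andbA [X in _ && X]andbC andbA nB.
Qed.

(** * The arrangement *)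

Section Geometry.
Variable R : realType.

Definition edge_hyperplane n (e : edge n) : set 'rV[R]_n :=
  diff_hyperplane R e.1.1 e.1.2 (gain e).

(** This makes subsets of the arrangement correspond to sets of edges. Translation along coordinate
    [k] preserves a hyperplane iff [k] is not one of its two indices, which recovers the pair
    [i < j]; the point [pt] then recovers the gain. *)
Lemma edge_hyperplane_inj n : {in edges n &, injective (@edge_hyperplane n)}.
Proof.
move=> [[i j] a] [[i' j'] a']; rewrite !inE /= => ij ij' H.
pose pt : 'rV[R]_n := (gain (i, j, a))%:~R *: delta_mx 0 i.
have nij : (i == j) = false by rewrite -val_eqE /= ltn_eqF.
have nij' : (i' == j') = false by rewrite -val_eqE /= ltn_eqF.
have sub x : edge_hyperplane (i, j, a) x -> edge_hyperplane (i', j', a') x by rewrite H.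
have ptP : edge_hyperplane (i, j, a) pt.
  rewrite /edge_hyperplane /diff_hyperplane /= !mxE !eqxx /= mulr1.
  by rewrite [j == i]eq_sym nij mulr0 subr0.
have := sub _ ptP; rewrite /edge_hyperplane /diff_hyperplane /= => pt'.
have other k : k != i -> k != j -> (k != i') && (k != j').
  move=> ki kj; have : edge_hyperplane (i, j, a) (pt + delta_mx 0 k).
    rewrite /edge_hyperplane /diff_hyperplane /= !mxE !eqxx /= mulr1.
    by rewrite [j == i]eq_sym nij [i == k]eq_sym [j == k]eq_sym (negbTE ki) (negbTE kj)
      mulr0 !addr0 subr0.
  have shift z : (pt + delta_mx 0 k) 0 z = pt 0 z + (z == k)%:R by rewrite !mxE.
  move/sub; rewrite /edge_hyperplane /diff_hyperplane /= !shift opprD addrACA.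
  rewrite pt' -[RHS]addr0 => /addrI; rewrite [i' == k]eq_sym [j' == k]eq_sym.
  case: eqP => [->|_]; first by rewrite nij' subr0 => /eqP; rewrite oner_eq0.
  by case: eqP => // _ /eqP; rewrite sub0r oppr_eq0 oner_eq0.
have i'P : (i' == i) || (i' == j).
  by apply: contraT => /norP[h1 h2]; have := other _ h1 h2; rewrite eqxx.
have j'P : (j' == i) || (j' == j).
  by apply: contraT => /norP[h1 h2]; have := other _ h1 h2; rewrite eqxx andbF.
have ii' : i' = i.
  case/orP: i'P => /eqP // i'j; case/orP: j'P => /eqP j'E.
    by move: ij'; rewrite i'j j'E ltnNge ltnW.
  by move: nij'; rewrite i'j j'E eqxx.
have jj' : j' = j by case/orP: j'P => /eqP // j'i; move: nij'; rewrite ii' j'i eqxx.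
move: pt'; rewrite ii' jj' (ptP) => /intr_inj.
by rewrite /gain /= => /val_inj ->.
Qed.

Definition hyperplanes_of n (B : {set edge n}) : {fset set 'rV[R]_n} :=
  [fset edge_hyperplane e | e in B]%fset.

Lemma hyperplanes_of_inj n (B C : {set edge n}) :
  B \subset edges n -> C \subset edges n ->
  hyperplanes_of B = hyperplanes_of C -> B = C.
Proof.
wlog suff sub : B C / B \subset edges n -> C \subset edges n ->
    hyperplanes_of B = hyperplanes_of C -> B \subset C.
  move=> BE CE BC; apply/eqP; rewrite finset.eqEsubset.
  by apply/andP; split; apply: sub.
move=> /fintype.subsetP BE /fintype.subsetP CE BC; apply/fintype.subsetP => e eB.
have : edge_hyperplane e \in hyperplanes_of B by apply/imfsetP; exists e.
rewrite BC => /imfsetP[e' /= e'C ee'].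
by rewrite (edge_hyperplane_inj (BE _ eB) (CE _ e'C) ee').
Qed.

Lemma card_hyperplanes_of n (B : {set edge n}) :
  B \subset edges n -> #|` hyperplanes_of B| = #|B|.
Proof.
move=> /fintype.subsetP BE; rewrite card_in_imfset /=; last first.
  by move=> e e' eB e'B; apply: edge_hyperplane_inj; apply: BE.
by rewrite cardE.
Qed.

Lemma E_hyperplanesE n : E_hyperplanes R A n = hyperplanes_of (edges n).
Proof.
apply/fsetP => H; apply/imfset2P/imfsetP => /= [[p pP [a aA ->]]|[e eE ->]].
  by exists (p, [` aA]%fset); rewrite // inE.
exists e.1; first by move: eE; rewrite inE.
by exists (fsval e.2); rewrite ?fsvalP.
Qed.

Lemma fpowerset_E n :
  perm_eq (fpowerset (E_hyperplanes R A n))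
    [seq hyperplanes_of B | B <- enum [set B : {set edge n} | B \subset edges n]%SET].
Proof.
apply: uniq_perm; first exact: fset_uniq.
  rewrite map_inj_in_uniq ?enum_uniq // => B C; rewrite !mem_enum !inE.
  exact: hyperplanes_of_inj.
move=> F; rewrite fpowersetE E_hyperplanesE; apply/idP/mapP => [/fsubsetP FE|[B]].
  exists [set e in edges n | edge_hyperplane e \in F]%SET.
    by rewrite mem_enum inE; apply/fintype.subsetP => e; rewrite inE => /andP[].
  apply/fsetP => H; apply/idP/imfsetP => [HF|[e /=]]; last first.
    by rewrite inE => /andP[_ ?] ->.
  have /imfsetP[e /= eE He] := FE H HF; exists e => //=.
  by rewrite inE eE -He.
rewrite mem_enum inE => /fintype.subsetP BE ->; apply/fsubsetP => H /imfsetP[e /= eB ->].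
by apply/imfsetP; exists e => //=; apply: BE.
Qed.

Lemma flatP n (B : {set edge n}) (x : 'rV[R]_n) :
  flat (hyperplanes_of B) x <->
  (forall e, e \in B -> x 0 e.1.1 - x 0 e.1.2 = (gain e)%:~R).
Proof.
split=> [xB e eB|xB H /= /imfsetP[e /= eB ->]]; last exact: xB.
by apply: (xB (edge_hyperplane e)); apply/imfsetP; exists e.
Qed.

(* The gains being integers, the floor of a real potential is a potential. *)
Lemma central_balanced n (B : {set edge n}) :
  central (hyperplanes_of B) <-> balanced B.
Proof.
split=> [[x /flatP xB]|[p pB]].
  exists (fun i => Num.floor (x 0 i)) => e eB.
  have -> : x 0 e.1.1 = x 0 e.1.2 + (gain e)%:~R by rewrite -(xB e eB) addrC subrK.
  by rewrite floorDrz ?intr_int // intrKfloor addrAC subrr add0r.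
exists (\row_i (p i)%:~R); apply/flatP => e eB.
by rewrite !mxE -intrB pB.
Qed.

(** The direction space consists of the differences of points of the affine set, so [xget] has only
    one value to choose. *)
Lemma affine_dimE n (p : 'rV[R]_n) (W : {vspace 'rV[R]_n}) :
  affine_dim [set p + w | w in [set` W]] = \dim W.
Proof.
apply: xget_unique; first by exists p, W.
move=> d [p' [W' [E ->]]]; congr (\dim _).
have sub (q q' : 'rV[R]_n) (V V' : {vspace 'rV[R]_n}) :
    [set q + w | w in [set` V]] = [set q' + w | w in [set` V']] -> (V <= V')%VS.
  move=> VV'; apply/subvP => v vV.
  have mem w : w \in V -> exists2 w', w' \in V' & q + w = q' + w'.
    move=> wV; have : [set q + w | w in [set` V]] (q + w) by exists w.
    by rewrite VV' => -[w' w'V' <-]; exists w'.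
  have [v1 v1V' e1] := mem _ vV; have [v0 v0V' e0] := mem 0 (mem0v _).
  have -> : v = v1 - v0.
    move: e1; rewrite -[q]addr0 e0 -addrA => /addrI <-.
    by rewrite addrAC subrr add0r.
  exact: rpredB.
by apply/eqP; rewrite eqEsubv (sub _ _ _ _ E) (sub _ _ _ _ (esym E)).
Qed.

(** Two points of the flat differ by a vector constant along the edges of [B]. Such vectors form the
    image of the pullback along [rho], which is injective because [rho] has the section [s]. *)
Lemma affine_dim_flat n (B : {set edge n}) : central (hyperplanes_of B) ->
  affine_dim (flat (hyperplanes_of B)) = ncomp B.
Proof.
move=> [p /flatP pB]; have [rho [s [sK rhoB constB]]] := componentsP B.
pose pull (y : 'rV[R]_(ncomp B)) : 'rV[R]_n := \row_i y 0 (rho i).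
have pull_lin : linear pull by move=> c y z; apply/rowP => i; rewrite !mxE.
pose pullL := GRing.isLinear.Build _ _ _ _ pull pull_lin.
pose L : {linear 'rV[R]_(ncomp B) -> 'rV[R]_n} := HB.pack pull pullL.
have -> : flat (hyperplanes_of B) = [set p + w | w in [set` limg (linfun L)]].
  apply/seteqP; split=> [x /flatP xB|_ [w /= /memv_imgP[y _ ->] <-]].
    exists (x - p); last by rewrite addrC subrK.
    apply/memv_imgP; exists (\row_i (x - p) 0 (s i)); first exact: memvf.
    rewrite lfunE; apply/rowP => i; rewrite !mxE.
    have := constB _ (fun i => x 0 i - p 0 i); apply => e eB.
    by apply/eqP; rewrite subr_eq addrAC -addrA (pB e eB) -(xB e eB) addrC subrK.
  rewrite (lfunE L y); apply/flatP => e eB; rewrite !mxE rhoB //.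
  by rewrite opprD addrACA subrr addr0 pB.
rewrite affine_dimE limg_dim_eq ?dimvf /dim /= ?mul1n //.
apply/eqP; rewrite capfv; apply/lker0P => y z; rewrite !(lfunE L) => yz.
apply/rowP => i; have /rowP/(_ (s i)) := yz.
by rewrite !mxE sK.
Qed.

(** A central [B] has rank [n.+1 - ncomp B], at most [n] as there is at least one component, and the
    star attains [n]. For empty [A] the rank would be 0. *)
Lemma arr_rankE n : A != fset0 -> arr_rank (E_arr R A n.+1) = n.
Proof.
move=> /fset0Pn[a aA]; rewrite /arr_rank /= (perm_big _ (fpowerset_E _)) big_map.
rewrite big_enum_cond /=; apply/eqP; rewrite eqn_leq; apply/andP; split.
  apply/bigmax_leqP => B /andP[_ /asboolP cB].
  rewrite /central_rank affine_dim_flat //.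
  by have := @ncomp_gt0 _ B isT; lia.
have [B [BE balB cB]] := ncomp_star n [` aA]%fset.
have cenB : central (hyperplanes_of B) by apply/central_balanced.
apply: (bigop.bigmax_sup B); first by rewrite inE BE; apply/asboolP.
by rewrite /central_rank affine_dim_flat // cB subn1.
Qed.

Lemma horner_coboundary n m : A != fset0 ->
  ('X * coboundary (E_arr R A n.+1)).[m%:R] = balanced_sum n.+1 m.
Proof.
move=> A0; rewrite hornerM hornerX /coboundary arr_rankE //=.
rewrite (perm_big _ (fpowerset_E _)) big_map big_enum_cond /=.
rewrite horner_sum mulr_sumr balanced_sumE; apply: eq_big => [B|B].
  by rewrite inE (asbool_equiv_eq (central_balanced B)).
rewrite inE => /andP[BE /asboolP cB].
rewrite card_hyperplanes_of // /central_rank affine_dim_flat // hornerM.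
have tE : ('X%:P - 1 : {poly {poly rat}}).[m%:R] = 'X - 1 by rewrite !hornerE.
rewrite hornerXn horner_exp tE mulrA -exprS -natrX mulr_natl.
congr (_ *+ (m ^ _)).
(* With [c = ncomp B], the claim is [(n - (n.+1 - c)).+1 = c], where the successor comes from the
   factor [q]; truncated subtraction requires [1 <= c <= n.+1]. *)
by have := ncomp_le B; have := @ncomp_gt0 _ B isT; lia.
Qed.

End Geometry.

(** * Multiplicativity of the generating functions, and the theorem *)

Lemma balanced_sum0n m : balanced_sum 0 m = 1.
Proof.
rewrite balanced_sumE (big_pred1 finset.set0) => [|B].
  rewrite cards0 expr0 (_ : ncomp _ = 0%N) //.
  by apply/eqP; rewrite -leqn0 ncomp_le.
have -> : B = finset.set0 by apply/setP => -[[[]]].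
rewrite /= eqxx finset.sub0set; apply/asboolP.
by exists (fun=> 0) => e; rewrite inE.
Qed.

Lemma balanced_sumn0 n : balanced_sum n.+1 0 = 0.
Proof. by rewrite /balanced_sum big1 // => g; case: (g ord0). Qed.

Definition balanced_egf m : fps {poly rat} :=
  fun n => (n`!%:R^-1 : rat) *: balanced_sum n m.

Lemma balanced_egf0 m : balanced_egf m 0%N = 1.
Proof. by rewrite /balanced_egf balanced_sum0n invr1 scale1r. Qed.

Lemma A_series0 r : A_series A r 0%N = 1.
Proof.
rewrite /A_series invr1 scale1r (big_pred1 (ffun0 (card_ord 0))) => [|f].
  by rewrite (_ : a_stat A _ = 0%N) //; apply: eq_card0 => -[[]].
by apply/esym/eqP/ffunP => -[].
Qed.

Lemma A_series_shift_le n : exists N, forall k m r, (k <= n)%N -> (N <= r)%N ->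
  A_series A (m + r) k = fps_mul (balanced_egf m) (A_series A r) k.
Proof.
have /choice[N NP] := A_series_shift.
exists (\sum_(i < n.+1) N i)%N => k m r kn Nr; apply: NP.
by rewrite (leq_trans _ Nr) // (bigD1 (Ordinal (kn : (k < n.+1)%N))) //= leq_addr.
Qed.

(** The series [A_series A (m.+1 + N)] arises from [A_series A N] by one shift of [m.+1], or by a
    shift of [m] followed by a shift of 1. Comparing the two and cancelling [A_series A N] gives the
    induction step. *)
Lemma balanced_egf_pow m n : balanced_egf m n = fps_pow (balanced_egf 1) m n.
Proof.
elim: m n => [|m IHm] n.
  case: n => [|n]; first by rewrite balanced_egf0 /= /fps_one.
  by rewrite /balanced_egf balanced_sumn0 scaler0.
have [N NP] := A_series_shift_le n.
apply: (fps_mulIr_trunc (A_series0 N)) => k kn.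
rewrite -NP // /= -(funext IHm) -fps_mulA addSn -add1n NP //; last exact: leq_addl.
by apply: fps_mul_eq => // i ik; rewrite NP // (leq_trans ik).
Qed.

End Counting.

Theorem theorem4p11 (R : realType) (A : {fset int}) (A_nonempty : A != fset0) :
  exists F : fps {poly rat},
    fps_cvg (fun r => fps_div (A_series A r) (A_series A r.-1)) F /\
    coboundary_series R A = fps_powq F.
Proof.
exists (balanced_egf A 1); split.
  (* The bound depends on the degree [b] in [x] alone: beyond it the whole coefficient, a polynomial
     in [t], is stationary. *)
  move=> a b; have [N NP] := A_series_shift_le A b.
  exists N => -[//|r] Nr; congr ((polyseq _)`_a).
  rewrite -(fps_mulrK (balanced_egf A 1) (A_series0 A r)).
  by apply: fps_mul_eq => // i ib; exact: (NP i 1%N).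
apply: fps_powqP => [n||m n].
- rewrite -polyC_natr rmorph_unit // unitfE pnatr_eq0 //.
- exact: balanced_egf0.
- rewrite -balanced_egf_pow /coboundary_series; case: n => [|n] /=.
    by rewrite hornerC balanced_egf0.
  by rewrite hornerM hornerC horner_coboundary // mulrC mul_polyC.
Qed.
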